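(* Let $T$ be a monoidal monad on a monoidal category $\mathcal{C}$. Then: (1) The Kleisli adjunction $\mathrm{Free}\dashv\mathrm{Forg}$, with $\mathrm{Free}\colon\mathcal{C}\to\mathbf{Klei}(T)$ and $\mathrm{Forg}\colon\mathbf{Klei}(T)\to\mathcal{C}$, is a monoidal adjunction. (2) For any monoidal adjunction $G\dashv R$, with $G\colon\mathcal{C}\to\mathcal{D}$ and $R\colon\mathcal{D}\to\mathcal{C}$, such that $T=RG$ as monoidal monads, the unique induced functor $\tilde G\colon\mathbf{Klei}(T)\to\mathcal{D}$ (the unique functor with $\tilde G\circ\mathrm{Free}=G$ and $R\circ\tilde G=\mathrm{Forg}$) becomes strong monoidal. (3) In the situation of (2), if the projection formula holds for $R$, then it holds for $\mathrm{Forg}$.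
   Context: Conventions: monoidal categories are written as if strict. A lax monoidal functor $F$ has structure maps $\mathrm{lax}^F_{X,Y}\colon FX\otimes FY\to F(X\otimes Y)$ and $\mathrm{lax}^F_0\colon\mathbb{1}\to F\mathbb{1}$ satisfying associativity and unitality; strong means these are invertible. A monoidal monad is a monad $(T,\mathrm{unit}^T,\mathrm{mul}^T)$ on a monoidal category with a lax monoidal structure on $T$ such that $\mathrm{unit}^T$ and $\mathrm{mul}^T$ are monoidal transformations. A monoidal adjunction $G\dashv R$ is an adjunction with $G,R$ lax monoidal and unit, counit monoidal transformations (then $G$ is strong monoidal, and $RG$ is a monoidal monad with multiplication $R(\mathrm{counit}_G)$). Kleisli category $\mathbf{Klei}(T)$: same objects as $\mathcal{C}$; a morphism $[\alpha]\colon A\to B$ is a morphism $\alpha\colon A\to TB$ in $\mathcal{C}$; identity $[\mathrm{unit}^T_A]$; $[\beta]\circ[\alpha]=[\mathrm{mul}^T_C\circ T\beta\circ\alpha]$. Its monoidal structure is that of $\mathcal{C}$ on objects, with $[\alpha]\otimes[\gamma]=[\mathrm{lax}^T_{B,D}\circ(\alpha\otimes\gamma)]$ for $[\alpha]\colon A\to B$, $[\gamma]\colon C\to D$. $\mathrm{Free}$ is the identity on objects and $\mathrm{Free}(\alpha)=[\mathrm{unit}^T_B\circ\alpha]$ for $\alpha\colon A\to B$; $\mathrm{Forg}(A)=TA$ and $\mathrm{Forg}([\alpha])=\mathrm{mul}^T_B\circ T\alpha$ for $[\alpha]\colon A\to B$. The lax structure of $\mathrm{Free}$ is given by identities and that of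 $\mathrm{Forg}$ by $\mathrm{lax}^T$. For a monoidal adjunction $G\dashv R$, set $\mathrm{lproj}_{A,X}=\mathrm{lax}^R_{GA,X}\circ(\mathrm{unit}_A\otimes RX)\colon A\otimes RX\to R(GA\otimes X)$ and $\mathrm{rproj}_{X,A}=\mathrm{lax}^R_{X,GA}\circ(RX\otimes\mathrm{unit}_A)\colon RX\otimes A\to R(X\otimes GA)$ for $A\in\mathcal{C}$, $X\in\mathcal{D}$. The projection formula holds for $R$ if all these morphisms are isomorphisms; for $\mathrm{Forg}$ it is applied to the monoidal adjunction $\mathrm{Free}\dashv\mathrm{Forg}$. *)

(* Defs.v *)
From Corelib Require Import ssreflect.

Set Implicit Arguments.
Unset Strict Implicit.
Unset Printing Implicit Defensive.

Declare Scope cat_scope.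
Delimit Scope cat_scope with cat.
Open Scope cat_scope.

#[local] Obligation Tactic := idtac.

Record Category : Type := MkCategory {
  ob :> Type;
  hom : ob -> ob -> Type;
  idm : forall X, hom X X;
  comp : forall X Y Z, hom Y Z -> hom X Y -> hom X Z;
  comp_assoc : forall X Y Z W (h : hom Z W) (g : hom Y Z) (f : hom X Y),
    comp h (comp g f) = comp (comp h g) f;
  comp_idl : forall X Y (f : hom X Y), comp (idm Y) f = f;
  comp_idr : forall X Y (f : hom X Y), comp f (idm X) = f
}.
Arguments hom {c} X Y.
Arguments idm {c} X.
Arguments comp {c X Y Z} g f.
Arguments comp_assoc {c X Y Z W} h g f.
Arguments comp_idl {c X Y} f.
Arguments comp_idr {c X Y} f.

Notation "g ∘ f" := (comp g f) (at level 40, left associativity) : cat_scope.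

Definition is_iso {C : Category} {X Y : C} (f : hom X Y) : Prop :=
  exists g : hom Y X, g ∘ f = idm X /\ f ∘ g = idm Y.

Record Functor (C D : Category) : Type := MkFunctor {
  fob :> C -> D;
  fmap : forall X Y : C, hom X Y -> hom (fob X) (fob Y);
  fmap_id : forall X, fmap (idm X) = idm (fob X);
  fmap_comp : forall X Y Z (g : hom Y Z) (f : hom X Y),
    fmap (g ∘ f) = fmap g ∘ fmap f
}.
Arguments fmap {C D} F {X Y} f : rename.
Arguments fmap_id {C D} F X : rename.
Arguments fmap_comp {C D} F {X Y Z} g f : rename.

Definition functor_id (C : Category) : Functor C C :=
  @MkFunctor C C (fun X => X) (fun X Y f => f)
    (fun X => eq_refl) (fun X Y Z g f => eq_refl).

Program Definition functor_comp (C D E : Category)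
    (F : Functor D E) (G : Functor C D) : Functor C E :=
  @MkFunctor C E (fun X => F (G X)) (fun X Y f => fmap F (fmap G f)) _ _.
Next Obligation. by move=> * /=; rewrite !fmap_id. Qed.
Next Obligation. by move=> * /=; rewrite !fmap_comp. Qed.

(* The associator and unitors are kept explicit, so that the results cover all
   monoidal categories and not only the strict ones. *)
Record MonoidalCategory : Type := MkMonoidalCategory {
  mcat :> Category;
  tunit : mcat;
  tens : mcat -> mcat -> mcat;
  tensm : forall X X' Y Y' : mcat,
    hom X X' -> hom Y Y' -> hom (tens X Y) (tens X' Y');
  tensm_id : forall X Y, tensm (idm X) (idm Y) = idm (tens X Y);
  tensm_comp : forall X X' X'' Y Y' Y''
      (f' : hom X' X'') (f : hom X X') (g' : hom Y' Y'') (g : hom Y Y'),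
    tensm (f' ∘ f) (g' ∘ g) = tensm f' g' ∘ tensm f g;
  assoc : forall X Y Z, hom (tens (tens X Y) Z) (tens X (tens Y Z));
  lunit : forall X, hom (tens tunit X) X;
  runit : forall X, hom (tens X tunit) X;
  assoc_iso : forall X Y Z, is_iso (assoc X Y Z);
  lunit_iso : forall X, is_iso (lunit X);
  runit_iso : forall X, is_iso (runit X);
  assoc_nat : forall X X' Y Y' Z Z'
      (f : hom X X') (g : hom Y Y') (h : hom Z Z'),
    assoc X' Y' Z' ∘ tensm (tensm f g) h = tensm f (tensm g h) ∘ assoc X Y Z;
  lunit_nat : forall X Y (f : hom X Y),
    lunit Y ∘ tensm (idm tunit) f = f ∘ lunit X;
  runit_nat : forall X Y (f : hom X Y),
    runit Y ∘ tensm f (idm tunit) = f ∘ runit X;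
  pentagon : forall X Y Z W,
    assoc X Y (tens Z W) ∘ assoc (tens X Y) Z W
    = tensm (idm X) (assoc Y Z W) ∘ assoc X (tens Y Z) W
        ∘ tensm (assoc X Y Z) (idm W);
  triangle : forall X Y,
    tensm (idm X) (lunit Y) ∘ assoc X tunit Y = tensm (runit X) (idm Y)
}.
Arguments tunit {m}.
Arguments tens {m} X Y.
Arguments tensm {m X X' Y Y'} f g.
Arguments tensm_id {m} X Y.
Arguments tensm_comp {m X X' X'' Y Y' Y''} f' f g' g.
Arguments assoc {m} X Y Z.
Arguments lunit {m} X.
Arguments runit {m} X.
Arguments assoc_nat {m X X' Y Y' Z Z'} f g h.
Arguments lunit_nat {m X Y} f.
Arguments runit_nat {m X Y} f.

Notation "X ⊗ Y" := (tens X Y) (at level 30, right associativity) : cat_scope.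
Notation "f ⊠ g" := (tensm f g) (at level 30, right associativity) : cat_scope.
Notation "𝟙" := tunit : cat_scope.

(* Only the data of a lax monoidal functor; the axioms are [is_lax_monoidal]. *)
Record LaxFunctorData (C D : MonoidalCategory) : Type := MkLaxFunctorData {
  lf_functor :> Functor C D;
  lax : forall X Y : C, hom (lf_functor X ⊗ lf_functor Y) (lf_functor (X ⊗ Y));
  lax0 : hom 𝟙 (lf_functor 𝟙)
}.
Arguments lax {C D} F X Y : rename.
Arguments lax0 {C D} F : rename.

Record is_lax_monoidal {C D : MonoidalCategory} (F : LaxFunctorData C D) : Prop :=
MkLaxMonoidal {
  lax_nat : forall (X X' Y Y' : C) (f : hom X X') (g : hom Y Y'),
    lax F X' Y' ∘ (fmap F f ⊠ fmap F g) = fmap F (f ⊠ g) ∘ lax F X Y;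
  lax_assoc : forall X Y Z : C,
    fmap F (assoc X Y Z) ∘ lax F (X ⊗ Y) Z ∘ (lax F X Y ⊠ idm (F Z))
    = lax F X (Y ⊗ Z) ∘ (idm (F X) ⊠ lax F Y Z) ∘ assoc (F X) (F Y) (F Z);
  lax_lunit : forall X : C,
    fmap F (lunit X) ∘ lax F 𝟙 X ∘ (lax0 F ⊠ idm (F X)) = lunit (F X);
  lax_runit : forall X : C,
    fmap F (runit X) ∘ lax F X 𝟙 ∘ (idm (F X) ⊠ lax0 F) = runit (F X)
}.

Definition is_strong_monoidal {C D : MonoidalCategory}
    (F : LaxFunctorData C D) : Prop :=
  is_lax_monoidal F /\ (forall X Y : C, is_iso (lax F X Y)) /\ is_iso (lax0 F).

Definition lax_id (C : MonoidalCategory) : LaxFunctorData C C :=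
  @MkLaxFunctorData C C (functor_id C) (fun X Y => idm (X ⊗ Y)) (idm 𝟙).

Definition lax_comp {C D E : MonoidalCategory}
    (F : LaxFunctorData D E) (G : LaxFunctorData C D) : LaxFunctorData C E :=
  @MkLaxFunctorData C E (functor_comp F G)
    (fun X Y => fmap F (lax G X Y) ∘ lax F (G X) (G Y))
    (fmap F (lax0 G) ∘ lax0 F).

Record is_monoidal_transformation {C D : MonoidalCategory}
    (F G : LaxFunctorData C D) (t : forall X : C, hom (F X) (G X)) : Prop :=
MkMonoidalTransformation {
  mt_nat : forall (X Y : C) (f : hom X Y), t Y ∘ fmap F f = fmap G f ∘ t X;
  mt_lax : forall X Y : C, t (X ⊗ Y) ∘ lax F X Y = lax G X Y ∘ (t X ⊠ t Y);
  mt_lax0 : t 𝟙 ∘ lax0 F = lax0 G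
}.

Record MonoidalMonad (C : MonoidalCategory) : Type := MkMonoidalMonad {
  mm_functor :> LaxFunctorData C C;
  munit : forall A : C, hom A (mm_functor A);
  mmul : forall A : C, hom (mm_functor (mm_functor A)) (mm_functor A);
  mm_lax : is_lax_monoidal mm_functor;
  munit_monoidal : is_monoidal_transformation (F := lax_id C) munit;
  mmul_monoidal :
    is_monoidal_transformation (F := lax_comp mm_functor mm_functor) mmul;
  mmul_assoc : forall A, mmul A ∘ fmap mm_functor (mmul A) = mmul A ∘ mmul (mm_functor A);
  mmul_unitl : forall A, mmul A ∘ munit (mm_functor A) = idm (mm_functor A);
  mmul_unitr : forall A, mmul A ∘ fmap mm_functor (munit A) = idm (mm_functor A)
}.
Arguments munit {C} T A : rename.
Arguments mmul {C} T A : rename.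

Record MonoidalAdjunctionData (C D : MonoidalCategory) : Type :=
MkMonoidalAdjunctionData {
  ladj : LaxFunctorData C D;
  radj : LaxFunctorData D C;
  adj_unit : forall A : C, hom A (radj (ladj A));
  adj_counit : forall X : D, hom (ladj (radj X)) X
}.
Arguments adj_unit {C D} M A : rename.
Arguments adj_counit {C D} M X : rename.

Record is_monoidal_adjunction {C D : MonoidalCategory}
    (M : MonoidalAdjunctionData C D) : Prop := MkIsMonoidalAdjunction {
  ladj_lax : is_lax_monoidal (ladj M);
  radj_lax : is_lax_monoidal (radj M);
  adj_unit_monoidal : is_monoidal_transformation
    (F := lax_id C) (G := lax_comp (radj M) (ladj M)) (adj_unit M);
  adj_counit_monoidal : is_monoidal_transformation
    (F := lax_comp (ladj M) (radj M)) (G := lax_id D) (adj_counit M);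
  adj_triangle_l : forall A : C,
    adj_counit M (ladj M A) ∘ fmap (ladj M) (adj_unit M A) = idm (ladj M A);
  adj_triangle_r : forall X : D,
    fmap (radj M) (adj_counit M X) ∘ adj_unit M (radj M X) = idm (radj M X)
}.

Record MonoidalAdjunction (C D : MonoidalCategory) : Type := MkMonoidalAdjunction {
  adj_data :> MonoidalAdjunctionData C D;
  adj_axioms : is_monoidal_adjunction adj_data
}.

Lemma lax_comp_is_lax {C D E : MonoidalCategory}
    (F : LaxFunctorData D E) (G : LaxFunctorData C D) :
  is_lax_monoidal F -> is_lax_monoidal G -> is_lax_monoidal (lax_comp F G).
Proof.
move=> HF HG; split=> /=.
- move=> X X' Y Y' f g.
  by rewrite -comp_assoc (lax_nat HF) !comp_assoc -!fmap_comp (lax_nat HG).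
- move=> X Y Z.
  rewrite -{1}(comp_idl (idm (F (G Z)))) -{1}(comp_idl (idm (F (G X)))) !tensm_comp.
  rewrite -(fmap_id F (G Z)) -(fmap_id F (G X)) !comp_assoc.
  rewrite -!fmap_comp -(comp_assoc (fmap F _) (lax F _ _)) (lax_nat HF).
  rewrite -(comp_assoc (fmap F (lax G X (Y ⊗ Z))) (lax F _ _)) (lax_nat HF).
  rewrite !comp_assoc -!fmap_comp (lax_assoc HG) !fmap_id.
  by rewrite !fmap_comp -!comp_assoc (comp_assoc _ (lax F _ _)) (lax_assoc HF) !comp_assoc.
- move=> X.
  rewrite -{1}(comp_idl (idm (F (G X)))) tensm_comp -(fmap_id F (G X)) !comp_assoc -!fmap_comp.
  rewrite -(comp_assoc (fmap F _) (lax F _ _)) (lax_nat HF) !comp_assoc -!fmap_comp.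
  by rewrite (lax_lunit HG) fmap_id (lax_lunit HF).
- move=> X.
  rewrite -{1}(comp_idl (idm (F (G X)))) tensm_comp -(fmap_id F (G X)) !comp_assoc -!fmap_comp.
  rewrite -(comp_assoc (fmap F _) (lax F _ _)) (lax_nat HF) !comp_assoc -!fmap_comp.
  by rewrite (lax_runit HG) fmap_id (lax_runit HF).
Qed.

(* The monad [R G] with multiplication [R counit_G] and the composite lax
   structure. *)
Program Definition adjunction_monad {C D : MonoidalCategory}
    (M : MonoidalAdjunction C D) : MonoidalMonad C :=
  @MkMonoidalMonad C (lax_comp (radj M) (ladj M)) (adj_unit M)
    (fun A => fmap (radj M) (adj_counit M (ladj M A))) _ _ _ _ _ _.
Next Obligation.
move=> C D [M HM] /=; exact: lax_comp_is_lax (radj_lax HM) (ladj_lax HM).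
Qed.
Next Obligation. move=> C D [M HM] /=; exact: adj_unit_monoidal HM. Qed.
Next Obligation.
move=> C D [M HM] /=.
have [Cn Cl C0] := adj_counit_monoidal HM.
split=> /=.
- by move=> X Y f; rewrite -!fmap_comp; congr (fmap _ _); apply: Cn.
- move=> X Y; have := Cl (ladj M X) (ladj M Y); rewrite /= comp_idl => E.
  rewrite -!comp_assoc (lax_nat (radj_lax HM)) !comp_assoc -!fmap_comp.
  congr (fmap _ _ ∘ _).
  have := Cn _ _ (lax (ladj M) X Y); rewrite /= => En.
  by rewrite fmap_comp !comp_assoc En -!comp_assoc E.
- move: C0; rewrite /= => E.
  have := Cn _ _ (lax0 (ladj M)); rewrite /= => En.
  rewrite !comp_assoc -!fmap_comp; congr (fmap _ _ ∘ _).
  by rewrite fmap_comp !comp_assoc En -!comp_assoc E comp_idr.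
Qed.
Next Obligation.
move=> C D [M HM] A /=; rewrite -!fmap_comp; congr (fmap _ _).
have [Cn _ _] := adj_counit_monoidal HM; exact: Cn.
Qed.
Next Obligation. move=> C D [M HM] A /=; exact: adj_triangle_r HM _. Qed.
Next Obligation.
by move=> C D [M HM] A /=; rewrite -fmap_comp (adj_triangle_l HM) fmap_id.
Qed.

Definition lproj {C D : MonoidalCategory} (M : MonoidalAdjunctionData C D)
    (A : C) (X : D) : hom (A ⊗ radj M X) (radj M (ladj M A ⊗ X)) :=
  lax (radj M) (ladj M A) X ∘ (adj_unit M A ⊠ idm (radj M X)).

Definition rproj {C D : MonoidalCategory} (M : MonoidalAdjunctionData C D)
    (X : D) (A : C) : hom (radj M X ⊗ A) (radj M (X ⊗ ladj M A)) :=
  lax (radj M) X (ladj M A) ∘ (idm (radj M X) ⊠ adj_unit M A).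

Definition projection_formula {C D : MonoidalCategory}
    (M : MonoidalAdjunctionData C D) : Prop :=
  (forall (A : C) (X : D), is_iso (lproj M A X)) /\
  (forall (X : D) (A : C), is_iso (rproj M X A)).

Section Kleisli.
Variables (C : MonoidalCategory) (T : MonoidalMonad C).
Implicit Types A B : C.

Definition klei_hom A B : Type := hom A (T B).

Definition klei_comp A B E (b : klei_hom B E) (a : klei_hom A B) : klei_hom A E :=
  mmul T E ∘ fmap T b ∘ a.

Definition klei_tensm A B A' B' (a : klei_hom A B) (c : klei_hom A' B') :
    klei_hom (A ⊗ A') (B ⊗ B') :=
  lax T B B' ∘ (a ⊠ c).

(* The action of [Free] on morphisms; it also transports the associator and the
   unitors of [C] to the Kleisli category. *)
Definition klei_pure A B (f : hom A B) : klei_hom A B := munit T B ∘ f.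

Lemma munit_nat A B (f : hom A B) : munit T B ∘ f = fmap T f ∘ munit T A.
Proof. exact: mt_nat (munit_monoidal T) _ _ f. Qed.

Lemma mmul_nat A B (f : hom A B) :
  mmul T B ∘ fmap T (fmap T f) = fmap T f ∘ mmul T A.
Proof. exact: mt_nat (mmul_monoidal T) _ _ f. Qed.

Lemma munit_lax A B : munit T (A ⊗ B) = lax T A B ∘ (munit T A ⊠ munit T B).
Proof. by rewrite -(mt_lax (munit_monoidal T)) comp_idr. Qed.

Lemma munit_lax0 : munit T 𝟙 = lax0 T.
Proof. by rewrite -(mt_lax0 (munit_monoidal T)) comp_idr. Qed.

Lemma klei_comp_pure_l A B E (f : hom B E) (a : klei_hom A B) :
  klei_comp (klei_pure f) a = fmap T f ∘ a.
Proof.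
by rewrite /klei_comp /klei_pure munit_nat fmap_comp comp_assoc mmul_nat
  -(comp_assoc (fmap T f)) mmul_unitr comp_idr.
Qed.

Lemma klei_comp_pure_r A B E (b : klei_hom B E) (f : hom A B) :
  klei_comp b (klei_pure f) = b ∘ f.
Proof.
by rewrite /klei_comp /klei_pure comp_assoc -(comp_assoc (mmul T E)) -munit_nat
  comp_assoc mmul_unitl comp_idl.
Qed.

Lemma klei_pure_comp A B E (g : hom B E) (f : hom A B) :
  klei_pure (g ∘ f) = klei_comp (klei_pure g) (klei_pure f).
Proof. by rewrite klei_comp_pure_r /klei_pure comp_assoc. Qed.

Lemma klei_pure_id A : klei_pure (idm A) = munit T A.
Proof. exact: comp_idr. Qed.

Lemma klei_tensm_pure A B A' B' (f : hom A B) (g : hom A' B') :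
  klei_tensm (klei_pure f) (klei_pure g) = klei_pure (f ⊠ g).
Proof. by rewrite /klei_tensm /klei_pure munit_lax tensm_comp comp_assoc. Qed.

Program Definition Klei_cat : Category :=
  @MkCategory C klei_hom (fun A => munit T A) klei_comp _ _ _.
Next Obligation.
move=> X Y Z W h g f; rewrite /klei_comp !fmap_comp !comp_assoc mmul_assoc.
by rewrite -(comp_assoc _ (mmul T (T W))) mmul_nat !comp_assoc.
Qed.
Next Obligation.
by move=> X Y f; rewrite /klei_comp mmul_unitr comp_idl.
Qed.
Next Obligation.
by move=> X Y f /=; rewrite -klei_pure_id klei_comp_pure_r comp_idr.
Qed.

Lemma klei_pure_iso A B (f : hom A B) :
  is_iso f -> @is_iso Klei_cat A B (klei_pure f).
Proof.
case=> g [gf fg]; exists (klei_pure g) => /=.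
by rewrite -!klei_pure_comp gf fg !klei_pure_id.
Qed.

Program Definition Klei : MonoidalCategory :=
  @MkMonoidalCategory Klei_cat 𝟙 (fun A B : C => A ⊗ B) klei_tensm _ _
    (fun A B E => klei_pure (assoc A B E))
    (fun A => klei_pure (lunit A)) (fun A => klei_pure (runit A))
    _ _ _ _ _ _ _ _.
Next Obligation. by move=> X Y; rewrite /klei_tensm -munit_lax. Qed.
Next Obligation.
move=> X X' X'' Y Y' Y'' f' f g' g; rewrite /= /klei_tensm /klei_comp !tensm_comp.
have /= Em := mt_lax (mmul_monoidal T) X'' Y''.
rewrite !comp_assoc -Em fmap_comp -!comp_assoc; do 2 congr (_ ∘ _).
by rewrite !comp_assoc (lax_nat (mm_lax T)).
Qed.
Next Obligation. by move=> X Y Z; apply: klei_pure_iso; apply: assoc_iso. Qed.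
Next Obligation. by move=> X; apply: klei_pure_iso; apply: lunit_iso. Qed.
Next Obligation. by move=> X; apply: klei_pure_iso; apply: runit_iso. Qed.
Next Obligation.
move=> X X' Y Y' Z Z' f g h; rewrite /= klei_comp_pure_l klei_comp_pure_r /klei_tensm.
rewrite -{1}(@comp_idl C _ _ h) -{2}(@comp_idl C _ _ f) !tensm_comp !comp_assoc (lax_assoc (mm_lax T)).
by rewrite -!comp_assoc assoc_nat.
Qed.
Next Obligation.
move=> X Y f; rewrite /= klei_comp_pure_l klei_comp_pure_r /klei_tensm munit_lax0.
rewrite -{1}(@comp_idl C _ _ f) -{1}(comp_idr (lax0 T)) tensm_comp !comp_assoc.
by rewrite (lax_lunit (mm_lax T)) lunit_nat.
Qed.
Next Obligation.
move=> X Y f; rewrite /= klei_comp_pure_l klei_comp_pure_r /klei_tensm munit_lax0.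
rewrite -{1}(@comp_idl C _ _ f) -{1}(comp_idr (lax0 T)) tensm_comp !comp_assoc.
by rewrite (lax_runit (mm_lax T)) runit_nat.
Qed.
Next Obligation.
move=> X Y Z W /=.
by rewrite -!klei_pure_id !klei_tensm_pure -!klei_pure_comp pentagon.
Qed.
Next Obligation.
move=> X Y /=.
by rewrite -!klei_pure_id !klei_tensm_pure -!klei_pure_comp triangle.
Qed.

Definition Free_functor : Functor C Klei :=
  @MkFunctor C Klei (fun A => A) klei_pure klei_pure_id klei_pure_comp.

Program Definition Forg_functor : Functor Klei C :=
  @MkFunctor Klei C (fun A => T A) (fun A B a => mmul T B ∘ fmap T a) _ _.
Next Obligation. by move=> X; exact: mmul_unitr. Qed.
Next Obligation.
move=> X Y Z g f; rewrite /= /klei_comp !fmap_comp !comp_assoc mmul_assoc.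
by rewrite -(comp_assoc _ (mmul T (T Z))) mmul_nat !comp_assoc.
Qed.

Definition Free : LaxFunctorData C Klei :=
  @MkLaxFunctorData C Klei Free_functor
    (fun A B => @idm Klei (A ⊗ B)) (@idm Klei 𝟙).

Definition Forg : LaxFunctorData Klei C :=
  @MkLaxFunctorData Klei C Forg_functor (fun A B => lax T A B) (lax0 T).

(* The counit at [A] is the Kleisli morphism [TA -> A] given by the identity
   of [TA] in [C]. *)
Definition kleisli_adjunction : MonoidalAdjunctionData C Klei :=
  @MkMonoidalAdjunctionData C Klei Free Forg
    (fun A => munit T A) (fun A => idm (T A)).

End Kleisli.

(* Main.v *)
(** For a monoidal adjunction [G ⊣ R] the map [lax^G] is invertible: its inverse
    is the transpose of [lax^R ∘ (η ⊗ η)]. The comparison functor acts by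
    [a ↦ ε ∘ G a] and inherits [lax^G]; it is unique because [k ↦ R k ∘ η] is
    injective on maps out of [G A], so [R H = Forg] fixes [H] on morphisms once
    [H] agrees with [G] on objects. Finally
    [lproj^Forg_{A,B} = R(lax^G_{A,B}) ∘ lproj^R_{A,GB}], and symmetrically for
    [rproj]. *)
From Corelib Require Import ssreflect.
From Stdlib Require Import FunctionalExtensionality ProofIrrelevance.
Require Import Defs.

Set Implicit Arguments.
Unset Strict Implicit.
Unset Printing Implicit Defensive.

(** * Isomorphisms and equality of functors *)

Lemma is_iso_comp (C : Category) (X Y Z : C) (g : hom Y Z) (f : hom X Y) :
  is_iso g -> is_iso f -> is_iso (g ∘ f).
Proof.
case=> g' [gK g'K] [f' [fK f'K]]; exists (f' ∘ g'); split.
- by rewrite comp_assoc -(comp_assoc f') gK comp_idr.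
- by rewrite comp_assoc -(comp_assoc g) f'K comp_idr.
Qed.

Lemma is_iso_fmap (C D : Category) (F : Functor C D) (X Y : C) (f : hom X Y) :
  is_iso f -> is_iso (fmap F f).
Proof.
by case=> g [gf fg]; exists (fmap F g); rewrite -!fmap_comp gf fg !fmap_id.
Qed.

(** Giving [fm] the object map of [F] in its type lets morphism maps be compared without transport;
    the proofs of the laws agree by proof irrelevance. *)
Lemma MkFunctor_eq (C D : Category) (F : Functor C D)
    (fm : forall X Y : C, hom X Y -> hom (F X) (F Y)) fm_id fm_comp :
  (forall X Y f, fm X Y f = fmap F f) -> @MkFunctor C D F fm fm_id fm_comp = F.
Proof.
case: F fm fm_id fm_comp => fo fm' i' c' /= fm i c E.
have {}E : fm = fm' by do 3 (apply: functional_extensionality_dep => ?).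
by subst fm; rewrite (proof_irrelevance _ i i') (proof_irrelevance _ c c').
Qed.

(** Injectivity of the constructor only equates dependent pairs over the object map; [inj_pair2]
    extracts the morphism maps. *)
Lemma MkFunctor_inj (C D : Category) (F : Functor C D)
    (fm : forall X Y : C, hom X Y -> hom (F X) (F Y)) fm_id fm_comp :
  @MkFunctor C D F fm fm_id fm_comp = F ->
  forall X Y (f : hom X Y), fm X Y f = fmap F f.
Proof.
case: F fm fm_id fm_comp => fo fm' i' c' /= fm i c E.
injection E => E'.
by rewrite (inj_pair2 _ _ _ _ _ E').
Qed.

Lemma MkLaxFunctorData_eq (C D : MonoidalCategory) (F : LaxFunctorData C D)
    (fm : forall X Y : C, hom X Y -> hom (F X) (F Y)) fm_id fm_comp
    (l : forall X Y : C, hom (F X ⊗ F Y) (F (X ⊗ Y))) (l0 : hom 𝟙 (F 𝟙)) :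
  (forall X Y f, fm X Y f = fmap F f) -> (forall X Y, l X Y = lax F X Y) ->
  l0 = lax0 F ->
  @MkLaxFunctorData C D (@MkFunctor C D F fm fm_id fm_comp) l l0 = F.
Proof.
case: F fm fm_id fm_comp l l0 => [[fo fm' i' c'] l' l0'] /= fm i c l l0 E El E0.
have {}E : fm = fm' by do 3 (apply: functional_extensionality_dep => ?).
have {}El : l = l' by do 2 (apply: functional_extensionality_dep => ?).
by subst; rewrite (proof_irrelevance _ i i') (proof_irrelevance _ c c').
Qed.

(** * The comparison functor of a monoidal adjunction *)

Section MonoidalAdjunctionTheory.
Variables (C D : MonoidalCategory) (M : MonoidalAdjunction C D).
Let G := ladj M.
Let R := radj M.
Let η A := adj_unit M A.
Let ε X := adj_counit M X.

Let G_lax : is_lax_monoidal G := ladj_lax (adj_axioms M).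
Let η_mon := adj_unit_monoidal (adj_axioms M).
Let ε_mon := adj_counit_monoidal (adj_axioms M).

Lemma adj_counit_nat X Y (f : hom X Y) : ε Y ∘ fmap G (fmap R f) = f ∘ ε X.
Proof. exact: mt_nat ε_mon _ _ f. Qed.

Lemma adj_counitK A : ε (G A) ∘ fmap G (η A) = idm (G A).
Proof. exact: adj_triangle_l (adj_axioms M) A. Qed.

Lemma adj_counit_lax X Y :
  ε (X ⊗ Y) ∘ (fmap G (lax R X Y) ∘ lax G (R X) (R Y)) = ε X ⊠ ε Y.
Proof. by have /= := mt_lax ε_mon X Y; rewrite comp_idl. Qed.

Lemma adj_unit_lax A B :
  η (A ⊗ B) = fmap R (lax G A B) ∘ lax R (G A) (G B) ∘ (η A ⊠ η B).
Proof. by have /= := mt_lax η_mon A B; rewrite comp_idr. Qed.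

Lemma adj_unit_lax0 : η 𝟙 = fmap R (lax0 G) ∘ lax0 R.
Proof. by have /= := mt_lax0 η_mon; rewrite comp_idr. Qed.

Lemma adj_transpose_inj A X (k l : hom (G A) X) :
  fmap R k ∘ η A = fmap R l ∘ η A -> k = l.
Proof.
(* The opposite transpose is a left inverse, by naturality of [ε] and a triangle identity. *)
have K (m : hom (G A) X) : ε X ∘ fmap G (fmap R m ∘ η A) = m.
  by rewrite fmap_comp comp_assoc adj_counit_nat -comp_assoc adj_counitK comp_idr.
by move=> E; rewrite -(K k) E K.
Qed.

Lemma ladj_lax_iso A B : is_iso (lax G A B).
Proof.
exists (ε (G A ⊗ G B) ∘ fmap G (lax R (G A) (G B) ∘ (η A ⊠ η B))); split.
(* Monoidality of [ε] turns this composite into a tensor of two triangle identities. *)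
- rewrite fmap_comp -!comp_assoc -(lax_nat G_lax).
  rewrite (comp_assoc (fmap G _)) comp_assoc adj_counit_lax -tensm_comp.
  by rewrite !adj_counitK tensm_id.
(* Moving [lax G] inside [ε] exposes [η (A ⊗ B)] by monoidality of [η]; one triangle identity
   remains. *)
- rewrite comp_assoc -adj_counit_nat -comp_assoc -fmap_comp comp_assoc.
  by rewrite -adj_unit_lax adj_counitK.
Qed.

(** The nullary analogue: the inverse is the transpose of [lax0 R]. *)
Lemma ladj_lax0_iso : is_iso (lax0 G).
Proof.
exists (ε 𝟙 ∘ fmap G (lax0 R)); split.
- by have /= := mt_lax0 ε_mon; rewrite comp_assoc.
- by rewrite comp_assoc -adj_counit_nat -comp_assoc -fmap_comp -adj_unit_lax0
    adj_counitK.
Qed.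

Let T := adjunction_monad M.

Program Definition comparison_functor : Functor (Klei T) D :=
  @MkFunctor (Klei T) D G (fun A B (a : @hom C A (R (G B))) => ε (G B) ∘ fmap G a)
    _ _.
Next Obligation. by move=> A; apply: adj_counitK. Qed.
Next Obligation.
move=> A B E b a; rewrite /= /klei_comp /= -!fmap_comp.
by rewrite (fmap_comp G (fmap R _)) !comp_assoc adj_counit_nat.
Qed.

Definition comparison : LaxFunctorData (Klei T) D :=
  @MkLaxFunctorData (Klei T) D comparison_functor (fun A B => lax G A B) (lax0 G).

(** The associator and unitors of [Klei T] are pure, so this reduces the coherence axioms of
    [comparison] to those of [G]. *)
Lemma comparison_pure A B (f : hom A B) :
  fmap comparison (klei_pure T f) = fmap G f.
Proof. by rewrite /= fmap_comp comp_assoc adj_counitK comp_idl. Qed.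

Lemma comparison_strong : is_strong_monoidal comparison.
Proof.
split; last by split; [exact: ladj_lax_iso | exact: ladj_lax0_iso].
split.
- move=> A A' B B' f g /=; rewrite /klei_tensm /=.
  (* Expanding [ε ⊠ ε] by monoidality of the counit produces the [lax R] contained in [lax T]. *)
  rewrite tensm_comp -adj_counit_lax !comp_assoc.
  rewrite -(comp_assoc _ (lax G (R (G A')) (R (G B')))) (lax_nat G_lax).
  by rewrite !fmap_comp !comp_assoc adj_counit_nat.
- move=> A B E; rewrite -[fmap comparison _]/(fmap comparison (klei_pure T _)).
  rewrite comparison_pure; exact: (lax_assoc G_lax).
- move=> A; rewrite -[fmap comparison _]/(fmap comparison (klei_pure T _)).
  rewrite comparison_pure; exact: (lax_lunit G_lax).
- move=> A; rewrite -[fmap comparison _]/(fmap comparison (klei_pure T _)).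
  rewrite comparison_pure; exact: (lax_runit G_lax).
Qed.

Lemma comparison_Free : lax_comp comparison (Free T) = G.
Proof.
apply: MkLaxFunctorData_eq => [A B f | A B |].
- exact: comparison_pure.
- by rewrite /= adj_counitK comp_idl.
- by rewrite /= adj_counitK comp_idl.
Qed.

(** On morphisms, [R] applied to [ε ∘ G a] is multiplication after [T a]; the lax structures agree
    by definition. *)
Lemma comparison_Forg : lax_comp R comparison = Forg T.
Proof.
by apply: (@MkLaxFunctorData_eq _ _ (Forg T)) => // A B f; exact: (fmap_comp R).
Qed.

Lemma comparison_unique (H : Functor (Klei T) D) :
  functor_comp H (Free T) = G -> functor_comp R H = Forg T ->
  lf_functor comparison = H.
Proof.
move=> EG ER; have eH : fob H = fob G := f_equal (@fob C D) EG.
(* Substituting the object map gives [hm] and the comparison functor morphism maps of the same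
   type. *)
case: H {EG} ER eH => h hm h_id h_comp ER /= eH; subst h.
symmetry; apply: (@MkFunctor_eq _ _ comparison_functor) => A B a.
have Ra := @MkFunctor_inj _ _ (Forg T) (fun X Y f => fmap R (hm X Y f)) _ _ ER.
by apply: adj_transpose_inj; rewrite Ra /= -fmap_comp.
Qed.

(** Both adjunctions have unit [η], and [lax T] is by definition
    [fmap R (lax G _ _) ∘ lax R _ _]. *)
Lemma lproj_Forg A B :
  lproj (kleisli_adjunction T) A B = fmap R (lax G A B) ∘ lproj M A (G B).
Proof. by rewrite /lproj comp_assoc. Qed.

Lemma rproj_Forg B A :
  rproj (kleisli_adjunction T) B A = fmap R (lax G B A) ∘ rproj M (G B) A.
Proof. by rewrite /rproj comp_assoc. Qed.

Lemma projection_formula_Forg :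
  projection_formula M -> projection_formula (kleisli_adjunction T).
Proof.
move=> [Hl Hr]; split=> [A B | B A].
- rewrite lproj_Forg; apply: is_iso_comp; last exact: Hl.
  by apply: is_iso_fmap; apply: ladj_lax_iso.
- rewrite rproj_Forg; apply: is_iso_comp; last exact: Hr.
  by apply: is_iso_fmap; apply: ladj_lax_iso.
Qed.

End MonoidalAdjunctionTheory.

(** * The Kleisli adjunction is monoidal *)

Section KleisliAdjunction.
Variables (C : MonoidalCategory) (T : MonoidalMonad C).

Lemma Forg_pure (A B : C) (f : hom A B) :
  fmap (Forg T) (klei_pure T f) = fmap T f.
Proof. by rewrite /= fmap_comp comp_assoc mmul_unitr comp_idl. Qed.

Lemma Free_lax : is_lax_monoidal (Free T).
Proof.
split=> [A A' B B' f g | A B E | A | A].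
- by rewrite comp_idl comp_idr; apply: klei_tensm_pure.
- by rewrite !tensm_id !comp_idl !comp_idr.
- by rewrite tensm_id !comp_idr.
- by rewrite tensm_id !comp_idr.
Qed.

Lemma Forg_lax : is_lax_monoidal (Forg T).
Proof.
have TL := mm_lax T.
split.
(* Naturality combines monoidality of [mmul] with naturality of [lax T]. *)
- move=> A A' B B' f g /=; rewrite /klei_tensm tensm_comp.
  have /= Em := mt_lax (mmul_monoidal T) A' B'.
  rewrite comp_assoc -Em fmap_comp -!comp_assoc (lax_nat TL).
  by rewrite !comp_assoc.
- move=> A B E; rewrite -[fmap (Forg T) _]/(fmap (Forg T) (klei_pure T _)).
  rewrite Forg_pure; exact: (lax_assoc TL).
- move=> A; rewrite -[fmap (Forg T) _]/(fmap (Forg T) (klei_pure T _)).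
  rewrite Forg_pure; exact: (lax_lunit TL).
- move=> A; rewrite -[fmap (Forg T) _]/(fmap (Forg T) (klei_pure T _)).
  rewrite Forg_pure; exact: (lax_runit TL).
Qed.

Lemma kleisli_adjunction_monoidal :
  is_monoidal_adjunction (kleisli_adjunction T).
Proof.
split; [exact: Free_lax | exact: Forg_lax | | | |].
- split=> [A B f | A B |].
  + rewrite -[RHS]/(fmap (Forg T) (klei_pure T f) ∘ munit T A) Forg_pure.
    exact: munit_nat.
  + by rewrite /= mmul_unitr !comp_idl comp_idr munit_lax.
  + by rewrite /= mmul_unitr comp_idl comp_idr munit_lax0.
(* For the counit, both sides reduce to [mmul T B ∘ fmap T f], to [lax T A B] and to [lax0 T],
   respectively. *)
- split=> [A B f | A B |] /=.
  + by rewrite klei_comp_pure_r /klei_comp comp_idl comp_idr.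
  + rewrite klei_comp_pure_l /klei_comp fmap_id comp_idr -munit_nat.
    by rewrite comp_assoc mmul_unitl mmul_unitr /klei_tensm tensm_id !comp_idl
      comp_idr.
  + rewrite klei_comp_pure_l /klei_comp fmap_id comp_idr -munit_nat.
    by rewrite comp_assoc mmul_unitl comp_idl munit_lax0.
- by move=> A /=; rewrite klei_comp_pure_r comp_idl.
- by move=> A /=; rewrite fmap_id comp_idr mmul_unitl.
Qed.

End KleisliAdjunction.

Theorem theorem3 (C : MonoidalCategory) (T : MonoidalMonad C) :
  is_monoidal_adjunction (kleisli_adjunction T)
  /\
  (forall (D : MonoidalCategory) (M : MonoidalAdjunction C D),
     T = adjunction_monad M ->
     exists Gt : LaxFunctorData (Klei T) D,
       unique (fun H : Functor (Klei T) D =>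
                 functor_comp H (Free T) = ladj M
                 /\ functor_comp (radj M) H = Forg T) Gt
       /\ is_strong_monoidal Gt
       /\ lax_comp Gt (Free T) = ladj M
       /\ lax_comp (radj M) Gt = Forg T)
  /\
  (forall (D : MonoidalCategory) (M : MonoidalAdjunction C D),
     T = adjunction_monad M ->
     projection_formula M ->
     projection_formula (kleisli_adjunction T)).
Proof.
split; first exact: kleisli_adjunction_monoidal.
split=> D M ET; last by rewrite ET; apply: projection_formula_Forg.
rewrite ET; exists (comparison M).
have EFree := comparison_Free M; have EForg := comparison_Forg M.
split; last by split; first exact: comparison_strong.
split; last by move=> H [EG ER]; apply: comparison_unique.
(* The equalities of lax functors project to the underlying functors. *)
split; first exact: (f_equal (@lf_functor _ _) EFree).
exact: (f_equal (@lf_functor _ _) EForg).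
Qed.
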